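(* Let $p$ be any of the following ten mesh patterns $(12,R)$, where $R$ is one of: $\{(1,2),(2,2),(0,1),(1,1),(0,0)\}$, $\{(2,2),(1,1),(2,1),(0,0),(1,0)\}$, $\{(1,2),(2,2),(0,1),(2,1),(0,0)\}$, $\{(1,2),(2,2),(0,1),(0,0),(1,0)\}$, $\{(1,2),(2,2),(2,1),(0,0),(1,0)\}$, $\{(2,2),(0,1),(2,1),(0,0),(1,0)\}$, $\{(0,2),(2,2),(1,1),(2,1),(1,0)\}$, $\{(0,2),(1,1),(2,1),(0,0),(1,0)\}$, $\{(1,2),(2,2),(0,1),(1,1),(2,0)\}$, $\{(1,2),(0,1),(1,1),(0,0),(2,0)\}$. Then the generating function $A(x)=\sum_{n\ge0}s_{n,0}(p)x^n$ of permutations avoiding $p$ is $$A(x)=\frac{F(x)}{1+x\sum_{n\ge1}n!\,H_n\,x^n},$$ where $F(x)=\sum_{n\ge0}n!x^n$ and $H_n=\sum_{k=1}^n\frac1k$ is the $n$-th harmonic number.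
   Context: For $R\subseteq\{0,1,2\}^2$ and $\pi=\pi_1\cdots\pi_n\in S_n$, an occurrence of the mesh pattern $(12,R)$ in $\pi$ is a pair of positions $i_1<i_2$ with $\pi_{i_1}<\pi_{i_2}$ such that, setting $x_0=0,x_1=i_1,x_2=i_2,x_3=n+1$ and $y_0=0,y_1=\pi_{i_1},y_2=\pi_{i_2},y_3=n+1$, for every $(a,b)\in R$ there is no index $k$ with $x_a<k<x_{a+1}$ and $y_b<\pi_k<y_{b+1}$. A permutation avoids $p$ if it has no occurrence of $p$; $s_{n,0}(p)$ is the number of permutations in $S_n$ avoiding $p$. Generating functions are formal power series. *)

(* Defs.v *)
From mathcomp Require Import all_boot all_order all_algebra all_fingroup.

Set Implicit Arguments.
Unset Strict Implicit.
Unset Printing Implicit Defensive.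

Import GRing.Theory.

Local Open Scope ring_scope.

(* A permutation of {1, ..., n} is represented by s : 'S_n acting on           *)
(* 'I_n = {0, ..., n-1}, so the 1-based position of i is i.+1 and the 1-based  *)
(* value there is (s i).+1. The grid lines below are kept 1-based, with        *)
(* sentinels 0 and n+1, so line c is meaningful for c <= 3.                    *)
Definition grid_line (n : nat) (u v : 'I_n) (c : nat) : nat :=
  nth 0%N [:: 0%N; u.+1; v.+1; n.+1] c.

(* The box (a, b) of the 3 x 3 grid: a is the column (positions), b is the row *)
(* (values, counted from the bottom).                                          *)
Notation box a b := (@Ordinal 3 a isT, @Ordinal 3 b isT) (only parsing).

Definition in_box (n : nat) (s : 'S_n) (i j : 'I_n) (z : 'I_3 * 'I_3)
    (k : 'I_n) : bool :=
  (grid_line i j z.1 < k.+1 < grid_line i j z.1.+1)%N &&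
  (grid_line (s i) (s j) z.2 < (s k).+1 < grid_line (s i) (s j) z.2.+1)%N.

Definition mesh12_occ (R : {set 'I_3 * 'I_3}) (n : nat) (s : 'S_n)
    (i j : 'I_n) : bool :=
  [&& (i < j)%N, (s i < s j)%N &
      [forall z in R, ~~ [exists k : 'I_n, in_box s i j z k]]].

Definition mesh12_avoids (R : {set 'I_3 * 'I_3}) (n : nat) (s : 'S_n) : bool :=
  ~~ [exists i : 'I_n, exists j : 'I_n, mesh12_occ R s i j].

Definition num_avoiders (R : {set 'I_3 * 'I_3}) (n : nat) : nat :=
  #|[set s : 'S_n | mesh12_avoids R s]|.

(* A formal power series is its coefficient sequence; equality of series is =1. *)
Definition fps (K : fieldType) : Type := nat -> K.

Section FormalPowerSeries.
Variable K : fieldType.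
Implicit Types f g : fps K.

Definition fps_one : fps K := fun n => (n == 0%N)%:R.
Definition fps_X : fps K := fun n => (n == 1%N)%:R.
Definition fps_add f g : fps K := fun n => f n + g n.
Definition fps_mul f g : fps K := fun n => \sum_(i < n.+1) f i * g (n - i)%N.

(* m is recursion fuel; m = n.+1 suffices for the coefficient of index n. *)
Fixpoint fps_inv_rec f (m n : nat) : K :=
  if m is m'.+1 then
    if n == 0%N then (f 0%N)^-1
    else - (f 0%N)^-1 * \sum_(1 <= k < n.+1) f k * fps_inv_rec f m' (n - k)%N
  else 0.

Definition fps_inv f : fps K := fun n => fps_inv_rec f n.+1 n.
Definition fps_div f g : fps K := fps_mul f (fps_inv g).

Lemma fps_inv_recE f m n : (n < m)%N -> fps_inv_rec f m n = fps_inv f n.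
Proof.
rewrite /fps_inv; move: {2}n.+1 (leqnn n.+1) => p; move: m n.
suff H q : forall m m' n, (n < q)%N -> (n < m)%N -> (n < m')%N ->
    fps_inv_rec f m n = fps_inv_rec f m' n.
  by move=> m n _ lt_nm; apply: (H n.+1).
elim: q => // q IHq [|m] [|m'] n //= lt_nq lt_nm lt_nm'.
case: eqP => // /eqP n_neq0; congr (_ * _).
rewrite !big_nat; apply: eq_bigr => k /andP[k_gt0 le_kn]; congr (_ * _).
have lt_nk : (n - k < n)%N by rewrite ltn_subrL k_gt0 lt0n.
by apply: IHq; apply: (leq_trans lt_nk).
Qed.

Lemma fps_mulfV f : f 0%N != 0 -> fps_mul f (fps_inv f) =1 fps_one.
Proof.
move=> f0 n; rewrite /fps_mul /fps_one big_ord_recl subn0.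
have [->|n_neq0] := eqVneq n 0%N.
  by rewrite big_ord0 addr0 /fps_inv /= mulfV.
rewrite {1}/fps_inv /= (negPf n_neq0) mulrA mulrN mulfV // mulN1r.
rewrite big_add1 big_mkord; apply/eqP; rewrite addrC subr_eq0; apply/eqP.
apply: eq_bigr => i _; rewrite fps_inv_recE //.
by rewrite ltn_subrL /= (leq_ltn_trans _ (ltn_ord i)).
Qed.

End FormalPowerSeries.

Arguments fps_one {K}.
Arguments fps_X {K}.

Declare Scope fps_scope.
Delimit Scope fps_scope with fps.
Bind Scope fps_scope with fps.
Notation "1" := fps_one : fps_scope.
Notation "''X'" := fps_X : fps_scope.
Notation "f + g" := (fps_add f g) : fps_scope.
Notation "f * g" := (fps_mul f g) : fps_scope.
Notation "f / g" := (fps_div f g) : fps_scope.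

Definition harmonic (n : nat) : rat := \sum_(1 <= k < n.+1) (k%:R)^-1.

Definition avoiders_gf (R : {set 'I_3 * 'I_3}) : fps rat :=
  fun n => (num_avoiders R n)%:R.

Definition factorial_gf : fps rat := fun n => (n`!)%:R.

(* The sum over n >= 1, hence the zero constant term. *)
Definition fact_harmonic_gf : fps rat :=
  fun n => if n == 0%N then 0 else (n`!)%:R * harmonic n.

(* Main.v *)
Require Import Defs.
From mathcomp Require Import all_boot all_order all_algebra all_fingroup.
From mathcomp Require Import zify.

(* Transposition (inverse permutations) and rotation by 180 degrees (reverse   *)
(* complements) reduce the ten patterns to three. In each of these, if a is    *)
(* the smaller value of an occurrence in w, the values below a form a block:   *)
(* deleting a and this block leaves a word v, and w is recovered from the      *)
(* block, v and the position t at which a was inserted; (a, b) is an           *)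
(* occurrence exactly when one prescribed entry b of v is minimal on a set of  *)
(* positions depending on t. For a' < a, the value a' starts an occurrence in  *)
(* w iff it starts one in the block below a, so the least a starting an        *)
(* occurrence is the one whose block avoids the pattern. Counting the words    *)
(* by this least a gives                                                       *)
(*   n! = s_n + \sum_(k < n) s_k * \sum_(t < m) m! / (t + 1),  m = n - 1 - k,  *)
(* because a given one of t + 1 entries is minimal in m! / (t + 1) words; this *)
(* is A(x) (1 + x \sum n! H_n x^n) = F(x).                                     *)

(** Write an occurrence (a, b) as a splitting w = U a V b Z. For the three representatives the mesh
    forces the values below a to fill exactly one of V and Z ([cond_inner], [cond_after],
    [cond_before]). The entries outside this block do not interfere with occurrences inside it,
    whence the nesting property ([cond_inner_nested] and its analogues): the starts below a are
    those of the block. So a word with occurrences has exactly one start whose block avoids the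
    pattern ([min_occ_unique]).

    For a fixed such start k, the word amounts to an avoiding block u, a position t and a word v on
    the m larger values in which one prescribed entry is minimal among t + 1 or m - t entries
    ([cond_inner_occ] and its analogues, [count_min_occ]). By symmetry among positions this leaves
    m!/(t + 1) or m!/(m - t) words v ([card_perm_argmin]), and either family sums over t to m! H_m.
    All patterns therefore satisfy the one recurrence [num_avoiding_rec], which [num_avoiding_gf]
    turns into the quotient of power series. *)

Set Implicit Arguments.
Unset Strict Implicit.
Unset Printing Implicit Defensive.

Import GRing.Theory Num.Theory.

(** * Division of formal power series *)

Section FormalPowerSeriesDivision.
Local Open Scope ring_scope.
Variable K : fieldType.
Implicit Types f g h : fps K.

(** Low coefficients of a product depend only on truncations of the factors, so ring laws can be
    imported from polynomials. *)
Lemma fps_mul_coefM f g n i : (i < n)%N ->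
  fps_mul f g i = ((\poly_(j < n) f j) * (\poly_(j < n) g j))`_i.
Proof.
move=> lt_in; rewrite coefM; apply: eq_bigr => j _; rewrite !coef_poly.
by rewrite (leq_ltn_trans (leq_ord j) lt_in) (leq_ltn_trans (leq_subr j i)).
Qed.

Lemma eq_fps_mul f f' g g' : f =1 f' -> g =1 g' -> fps_mul f g =1 fps_mul f' g'.
Proof. by move=> eqf eqg n; apply: eq_bigr => i _; rewrite eqf eqg. Qed.

Lemma fps_mulA f g h : fps_mul f (fps_mul g h) =1 fps_mul (fps_mul f g) h.
Proof.
move=> n; pose T (u : fps K) : {poly K} := \poly_(j < n.+1) u j.
have TM u v i : (i <= n)%N -> (T (fps_mul u v))`_i = (T u * T v)`_i.
  by move=> le_in; rewrite coef_poly ltnS le_in (@fps_mul_coefM _ _ n.+1).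
(* Truncating the inner product once more does not affect the coefficient of index n. *)
have step u v w : (T (fps_mul u v) * w)`_n = (T u * T v * w)`_n.
  rewrite !coefM; apply: eq_bigr => i _; congr (_ * _).
  by rewrite TM ?coefM // leq_ord.
rewrite !(@fps_mul_coefM _ _ n.+1) // -/(T f) -/(T h) -/(T (fps_mul g h)).
by rewrite -/(T (fps_mul f g)) step mulrC step mulrC mulrA.
Qed.

Lemma fps_mul1 f : fps_mul f 1%fps =1 f.
Proof.
move=> n; rewrite /fps_mul big_ord_recr /= subnn mulr1 big1 ?add0r // => i _.
by rewrite /fps_one subn_eq0 leqNgt ltn_ord mulr0.
Qed.

(** Since h = h (g g^-1) = (h g) g^-1, associativity and the right inverse suffice. *)
Lemma fps_div_unique f g h : g 0%N != 0 -> fps_mul h g =1 f -> h =1 fps_div f g.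
Proof.
move=> g0 eq_hg n; rewrite -[LHS]fps_mul1.
rewrite -(eq_fps_mul (frefl h) (fps_mulfV g0)) fps_mulA.
exact: eq_fps_mul.
Qed.

End FormalPowerSeriesDivision.

(** * Symmetries of mesh patterns *)

Section Symmetries.
Variable n : nat.
Implicit Types (R : {set 'I_3 * 'I_3}) (s : 'S_n).

(** Inversion reflects the diagram in its diagonal: the point (i, s i) becomes (s i, i), and rows
    and columns of boxes are exchanged. *)
Lemma mesh12_occ_inv R s i j :
  mesh12_occ [set z | (z.2, z.1) \in R] s^-1 (s i) (s j) = mesh12_occ R s i j.
Proof.
have box_inv z k : in_box s^-1 (s i) (s j) (z.2, z.1) (s k) = in_box s i j z k.
  by rewrite /in_box !permK andbC.
rewrite /mesh12_occ !permK andbCA; congr [&& _, _ & _].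
apply/forall_inP/forall_inP => [H z Rz | H [z2 z1]].
  have := H (z.2, z.1); rewrite inE -surjective_pairing => /(_ Rz).
  apply: contra => /existsP[k kz].
  by apply/existsP; exists (s k); rewrite box_inv.
rewrite inE => /H; apply: contra => /existsP[k kz].
by apply/existsP; exists (s^-1 k)%g; rewrite -box_inv permKV.
Qed.

Definition rev_perm : 'S_n := perm rev_ord_inj.

Lemma rev_permE i : rev_perm i = rev_ord i.
Proof. exact: permE. Qed.

(** The reflection fails beyond c = 3, where [grid_line] takes its default value 0. *)
Lemma grid_line_rev (i j : 'I_n) c : (c <= 3)%N ->
  grid_line (rev_ord j) (rev_ord i) c = (n.+1 - grid_line i j (3 - c))%N.
Proof.
have := ltn_ord i; have := ltn_ord j.
by move: c => [|[|[|[|//]]]] *; rewrite ?subSS ?subn0 /grid_line /=; lia.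
Qed.

Lemma grid_line_le (i j : 'I_n) c : (grid_line i j c <= n.+1)%N.
Proof.
have := ltn_ord i; have := ltn_ord j.
by move: c => [|[|[|[|c]]]] *; rewrite /grid_line //= ?nth_nil //; lia.
Qed.

(** A half turn of the diagram keeps the pattern 12 but exchanges its two points, and sends box (a,
    b) to (2 - a, 2 - b). *)
Lemma mesh12_occ_revcomp R s i j :
  mesh12_occ [set z | (rev_ord z.1, rev_ord z.2) \in R]
    (rev_perm * s * rev_perm) (rev_ord j) (rev_ord i) = mesh12_occ R s i j.
Proof.
have revcompE k : (rev_perm * s * rev_perm)%g (rev_ord k) = rev_ord (s k).
  by rewrite !permM !rev_permE rev_ordK.
have mid (u v k : 'I_n) (c : 'I_3) :
    (grid_line (rev_ord v) (rev_ord u) (rev_ord c) < (rev_ord k).+1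
       < grid_line (rev_ord v) (rev_ord u) (rev_ord c).+1)%N
    = (grid_line u v c < k.+1 < grid_line u v c.+1)%N.
  have c3 := ltn_ord c; have k_n := ltn_ord k.
  have le1 := grid_line_le u v c; have le2 := grid_line_le u v c.+1.
  rewrite !grid_line_rev /=; try lia.
  have -> : (3 - (3 - c.+1) = c.+1)%N by lia.
  have -> : (3 - (3 - c.+1).+1 = c)%N by lia.
  lia.
have box_rc z k : in_box (rev_perm * s * rev_perm) (rev_ord j) (rev_ord i)
    (rev_ord z.1, rev_ord z.2) (rev_ord k) = in_box s i j z k.
  by rewrite /in_box !revcompE !mid.
rewrite /mesh12_occ !revcompE; congr [&& _, _ & _].
- by have := ltn_ord i; have := ltn_ord j; rewrite /=; lia.
- by have := ltn_ord (s i); have := ltn_ord (s j); rewrite /=; lia.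
apply/forall_inP/forall_inP => [H z Rz | H z].
  have := H (rev_ord z.1, rev_ord z.2).
  rewrite inE /= !rev_ordK -surjective_pairing => /(_ Rz).
  apply: contra => /existsP[k kz].
  by apply/existsP; exists (rev_ord k); rewrite box_rc.
rewrite inE => /H; apply: contra => /existsP[k kz].
apply/existsP; exists (rev_ord k); rewrite -box_rc /= !rev_ordK.
by rewrite -surjective_pairing.
Qed.

Lemma num_avoiders_sym R R' (f : 'S_n -> 'S_n) : injective f ->
    (forall s, mesh12_avoids R' (f s) = mesh12_avoids R s) ->
  num_avoiders R' n = num_avoiders R n.
Proof.
move=> f_inj fP; rewrite /num_avoiders -(card_preimset _ f_inj).
by apply: eq_card => s; rewrite !inE fP.
Qed.

Lemma num_avoiders_inv R :
  num_avoiders [set z | (z.2, z.1) \in R] n = num_avoiders R n.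
Proof.
apply: (num_avoiders_sym (@invg_inj _)) => s; congr (~~ _).
apply/existsP/existsP => [] [i /existsP[j ij]].
  exists (s^-1 i)%g; apply/existsP; exists (s^-1 j)%g.
  by rewrite -mesh12_occ_inv !permKV.
by exists (s i); apply/existsP; exists (s j); rewrite mesh12_occ_inv.
Qed.

Lemma num_avoiders_revcomp R :
  num_avoiders [set z | (rev_ord z.1, rev_ord z.2) \in R] n = num_avoiders R n.
Proof.
apply: (@num_avoiders_sym _ _ (fun s => rev_perm * s * rev_perm)%g).
  by move=> s t /mulIg/mulgI.
move=> s; congr (~~ _); apply/existsP/existsP => [] [i /existsP[j ij]].
  exists (rev_ord j); apply/existsP; exists (rev_ord i).
  by rewrite -mesh12_occ_revcomp !rev_ordK.
exists (rev_ord j); apply/existsP; exists (rev_ord i).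
by rewrite mesh12_occ_revcomp.
Qed.

End Symmetries.

(** * Permutations as words *)

Section Words.
Variable n : nat.
Implicit Types s : 'S_n.

(** The offset [c] makes room for words on a higher interval of values, such as those above an
    occurrence start. *)
Definition word c s : seq nat := [seq c + s i | i <- enum 'I_n].

Lemma size_word c s : size (word c s) = n.
Proof. by rewrite size_map size_enum_ord. Qed.

Lemma nth_word c s (i : 'I_n) : nth 0 (word c s) i = c + s i.
Proof. by rewrite (nth_map i) ?size_enum_ord // nth_ord_enum. Qed.

Lemma word_inj c : injective (word c).
Proof.
move=> s t eq_st; apply/permP => i; apply/val_inj/(@addnI c).
by rewrite -!nth_word eq_st.
Qed.

Lemma word_uniq c s : uniq (word c s).
Proof.
by rewrite map_inj_uniq ?enum_uniq // => i j /addnI/val_inj; apply: perm_inj.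
Qed.

Lemma perm_word c s : perm_eq (word c s) (iota c n).
Proof.
apply: uniq_perm; rewrite ?word_uniq ?iota_uniq //.
have sub_w : {subset word c s <= iota c n}.
  by move=> _ /mapP[i _ ->]; rewrite mem_iota leq_addr ltn_add2l ltn_ord.
by have [] := uniq_min_size (word_uniq c s) sub_w; rewrite // size_iota size_word.
Qed.

Lemma perm_words c :
  perm_eq [seq word c s | s <- enum {: 'S_n}] (permutations (iota c n)).
Proof.
have uw : uniq [seq word c s | s <- enum {: 'S_n}].
  by rewrite map_inj_uniq ?enum_uniq //; apply: word_inj.
apply: uniq_perm; rewrite ?permutations_uniq //.
have sub_w : {subset [seq word c s | s <- enum {: 'S_n}]
                <= permutations (iota c n)}.
  by move=> _ /mapP[s _ ->]; rewrite mem_permutations perm_word.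
(* An inclusion of duplicate-free lists is an equality of members once the sizes agree; here both
   are n!. *)
have [] := uniq_min_size uw sub_w => //.
rewrite size_permutations ?iota_uniq // size_iota size_map -cardE.
by rewrite -card_Sn; apply: subset_leq_card; apply/subsetP.
Qed.

Lemma count_permutations_iota P c :
  count P (permutations (iota c n)) = #|[set s : 'S_n | P (word c s)]|.
Proof.
rewrite -(seq.permP (perm_words c)) count_map -size_filter cardE.
rewrite /enum_mem -filter_predI size_filter [RHS]size_filter.
by apply: eq_count => s; rewrite !inE andbT.
Qed.

End Words.

(* Transposing p with q exchanges the permutations that attain their minimum   *)
(* over T at p with those that attain it at q.                                 *)
Lemma card_perm_argmin n (T : {set 'I_n}) (p : 'I_n) : p \in T ->
  #|T| * #|[set s : 'S_n | [forall q in T, s p <= s q]]| = n`!.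
Proof.
move=> pT; pose A q := [set s : 'S_n | [forall r in T, s q <= s r]].
have cardA q : q \in T -> #|A q| = #|A p|.
  move=> qT; rewrite -(card_preimset (A p) (can_inj (mulKg (tperm p q)))).
  apply: eq_card => s; rewrite !inE permM tpermL.
  apply/forall_inP/forall_inP => H r rT.
    by rewrite permM; apply: H; case: tpermP => // ->.
  have := H (tperm p q r); rewrite permM tpermK; apply.
  by case: tpermP => // ->.
rewrite -sum_nat_const -(eq_bigr _ cardA) -[RHS]card_Sn -sum1_card.
(* Each permutation attains its minimum over [T] at exactly one position, so the classes [A q]
   partition the n! permutations. *)
transitivity (\sum_(q in T) \sum_(s : 'S_n | s \in A q) 1).
  by apply: eq_bigr => q _; rewrite sum1_card.
rewrite (exchange_big_dep predT) //=; apply: eq_big => [s | s _].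
  by rewrite inE.
case: (arg_minnP (fun q => s q : nat) pT) => q qT qmin.
rewrite (big_pred1 q) // => r; rewrite inE; apply/andP/eqP => [[rT rmin] | ->].
  apply: (@perm_inj _ s); apply/val_inj/eqP; rewrite eqn_leq qmin // andbT.
  exact: (forall_inP rmin).
by split=> //; apply/forall_inP => r'; apply: qmin.
Qed.

(** Word form of [card_perm_argmin]. Here [T] lists only the competitors of p, hence the successor
    in the factor and the strict comparison. *)
Lemma count_argmin m c p (T : seq nat) :
    uniq (p :: T) -> all (ltn^~ m) (p :: T) ->
  (size T).+1 *
    count (fun v => all (fun q => nth 0 v p < nth 0 v q) T)
      (permutations (iota c m)) = m`!.
Proof.
move=> /andP[pT uT] /andP[lt_pm /allP ltT]; pose p' := Ordinal lt_pm.
pose T' := [set q : 'I_m | (q : nat) \in p :: T].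
have p'T : p' \in T' by rewrite inE mem_head.
have cardT' : #|T'| = (size T).+1.
  rewrite cardE -(size_map val); apply: (@perm_size _ _ (p :: T)).
  apply: uniq_perm => [||q]; rewrite ?(map_inj_uniq val_inj) ?enum_uniq //=.
    by rewrite pT.
  apply/mapP/idP => [[q' ] | qT]; first by rewrite mem_enum inE => ? ->.
  have lt_qm : q < m by move: qT; rewrite inE => /predU1P[-> //|/ltT].
  by exists (Ordinal lt_qm); rewrite // mem_enum inE.
rewrite -(card_perm_argmin p'T) count_permutations_iota cardT'; congr (_ * _).
apply: eq_card => s; rewrite !inE.
have nthw q (lt_qm : q < m) : nth 0 (word c s) q = c + s (Ordinal lt_qm).
  exact: (nth_word c s (Ordinal lt_qm)).
apply/allP/forall_inP => [H q | H q qT].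
  rewrite inE => /predU1P[eq_qp | qT]; first by rewrite (_ : q = p') //; apply: val_inj.
  by have := H _ qT; rewrite nth_word (nthw p lt_pm) ltn_add2l => /ltnW.
rewrite (nthw q (ltT q qT)) (nthw p lt_pm) ltn_add2l ltn_neqAle.
rewrite (H (Ordinal (ltT q qT))) ?inE ?qT ?orbT // andbT.
apply: contra pT => /eqP/val_inj/perm_inj/(congr1 val)/= eq_pq.
by rewrite eq_pq.
Qed.

(** * Least occurrences in words *)

Section WordOccurrences.
Variable cond : seq nat -> nat -> seq nat -> nat -> seq nat -> bool.
Implicit Types (a k : nat) (w U V Z : seq nat).

(* [cond U a V b Z] decides whether (a, b) is an occurrence in U a V b Z.      *)
Definition occ_at a w : bool :=
  (a \in w) &&
  let r := drop (index a w).+1 w in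
  has (fun b => cond (take (index a w) w) a
                     (take (index b r) r) b (drop (index b r).+1 r)) r.

Definition has_occ w : bool := has (fun a => occ_at a w) w.

(** Without repeated entries the splitting at a and b is unique, so the one computed by [index]
    agrees with any given one. *)
Lemma occ_atP a w : uniq w ->
  reflect (exists U V b Z, w = U ++ a :: V ++ b :: Z /\ cond U a V b Z)
          (occ_at a w).
Proof.
move=> uw; apply: (iffP andP) => [[wa /hasP[b rb abP]] | [U [V [b [Z [eq_w cP]]]]]].
  set r := drop _ w in rb abP.
  exists (take (index a w) w), (take (index b r) r), b, (drop (index b r).+1 r).
  by rewrite -drop_index // cat_take_drop -drop_index // cat_take_drop.
move: uw; rewrite eq_w cat_uniq /= negb_or cat_uniq /= negb_or.
move=> /and3P[_ /andP[aU _] /andP[_ /and3P[_ /andP[bV _] _]]].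
rewrite mem_cat mem_head orbT; split=> //=.
rewrite index_pivot // take_size_cat // -cat_rcons drop_size_cat ?size_rcons //.
apply/hasP; exists b; first by rewrite mem_cat mem_head orbT.
by rewrite index_pivot // take_size_cat // -cat_rcons drop_size_cat ?size_rcons.
Qed.

Lemma occ_at_mem a w : occ_at a w -> a \in w.
Proof. by case/andP. Qed.

Lemma has_occP w : reflect (exists a, occ_at a w) (has_occ w).
Proof.
apply: (iffP hasP) => [[a _ aw] | [a aw]]; first by exists a.
by exists a; rewrite ?occ_at_mem.
Qed.

Definition num_avoiding n := count (predC has_occ) (permutations (iota 0 n)).

Hypothesis occ_at_nested : forall w a a', uniq w -> a' < a -> occ_at a w ->
  occ_at a' [seq x <- w | x < a] = occ_at a' w.

(** If there are occurrences, the single nonzero term of the sum belongs to the least start: by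
    nesting, an occurrence below k would give a smaller start of w. *)
Lemma min_occ_unique n w : perm_eq w (iota 0 n) ->
  ~~ has_occ w + \sum_(k < n) (occ_at k w && ~~ has_occ [seq x <- w | x < k]) = 1.
Proof.
move=> pw; have uw : uniq w by rewrite (perm_uniq pw) iota_uniq.
have [/has_occP ex_a | no_occ] := boolP (has_occ w); last first.
  rewrite big1 // => k _; case: (boolP (occ_at k w)) => // kw.
  by case/has_occP: no_occ; exists k.
case: (ex_minnP ex_a) => k kw kmin.
have lt_kn : k < n by have := occ_at_mem kw; rewrite (perm_mem pw) mem_iota.
rewrite add0n (bigD1 (Ordinal lt_kn)) //= kw big1 ?addn0 => [|i ne_ik].
  case: has_occP => //= - [a ak].
  have lt_ak : a < k by have := occ_at_mem ak; rewrite mem_filter => /andP[].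
  by move: ak; rewrite occ_at_nested // => /kmin; rewrite leqNgt lt_ak.
(* Any other start i exceeds the least start k, and k is still a start in the subword below i. *)
apply/eqP; rewrite eqb0 negb_and negbK; apply/orP.
case: (boolP (occ_at i w)) => [iw | _]; [right | by left].
apply/has_occP; exists k; rewrite occ_at_nested // ltn_neqAle kmin // andbT.
by rewrite eq_sym.
Qed.

Lemma sum_min_occ n :
  num_avoiding n + \sum_(k < n)
    count (fun w => occ_at k w && ~~ has_occ [seq x <- w | x < k])
      (permutations (iota 0 n)) = n`!.
Proof.
have countE (P : pred (seq nat)) s : count P s = \sum_(w <- s) P w.
  by rewrite -sumn_count sumnE big_map.
rewrite -[in RHS](size_iota 0 n) -(size_permutations (iota_uniq 0 n)) -sum1_size.
rewrite /num_avoiding countE.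
under [X in _ + X]eq_bigr => k _ do rewrite countE.
rewrite exchange_big -big_split /= !big_seq; apply: eq_bigr => w.
by rewrite mem_permutations => /min_occ_unique.
Qed.

End WordOccurrences.

(** * Block insertions and the count of words with a given least start *)

Section Insertion.
Variable inner : bool.

(* k is inserted at position t of v; the block u of smaller values goes right  *)
(* after k if [inner] holds, and to the end of the word otherwise.             *)
Definition insert_block k t (u v : seq nat) : seq nat :=
  take t v ++ k :: if inner then u ++ drop t v else drop t v ++ u.

Variables (k t : nat) (u v : seq nat).
Lemma perm_insert_block : perm_eq (insert_block k t u v) (u ++ k :: v).
Proof.
apply/seq.permP => P; rewrite /insert_block -[v in RHS](cat_take_drop t).
by case: inner; rewrite !count_cat /= !count_cat; lia.
Qed.

Lemma filter_take_drop (p : pred nat) :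
  [seq x <- take t v | p x] ++ [seq x <- drop t v | p x] = [seq x <- v | p x].
Proof. by rewrite -filter_cat cat_take_drop. Qed.

Hypotheses (ltu : all (ltn^~ k) u) (gtv : all (ltn k) v).

(** With [insert_block_gt] and [index_insert_block], this recovers u, v and t from the word, so
    insertion is injective. *)
Lemma insert_block_lt : [seq x <- insert_block k t u v | x < k] = u.
Proof.
have v0 : [seq x <- v | x < k] = [::].
  rewrite -(filter_pred0 v); apply: eq_in_filter => x /(allP gtv) /=; lia.
have := filter_take_drop (ltn^~ k); rewrite v0.
case E1: [seq x <- take t v | x < k] => //= E2.
rewrite filter_cat E1 /= ltnn; case: inner; rewrite filter_cat E2 ?cats0 /=;
  exact/all_filterP.
Qed.

Lemma insert_block_gt : [seq x <- insert_block k t u v | k < x] = v.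
Proof.
have u0 : [seq x <- u | k < x] = [::].
  rewrite -(filter_pred0 u); apply: eq_in_filter => x /(allP ltu) /=; lia.
rewrite filter_cat /= ltnn -[RHS](all_filterP gtv) -filter_take_drop.
by case: inner; rewrite filter_cat u0 ?cats0.
Qed.

Lemma index_insert_block : t <= size v -> index k (insert_block k t u v) = t.
Proof.
move=> le_tv; rewrite index_pivot ?size_takel //.
by apply/negP => /mem_take/(allP gtv) /=; rewrite ltnn.
Qed.

End Insertion.

Section CountInsertions.
Variable cond : seq nat -> nat -> seq nat -> nat -> seq nat -> bool.
Variables (inner : bool) (p : nat -> nat -> nat) (T : nat -> nat -> seq nat).

(** [p m t] is the position in v of the larger pattern entry b, and [T m t] lists the positions
    whose entries must exceed b. *)
Definition argmin_at m t (v : seq nat) : bool :=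
  all (fun q => nth 0 v (p m t) < nth 0 v q) (T m t).

Hypothesis occ_atE : forall k w, uniq w ->
  let v := [seq x <- w | k < x] in
  occ_at cond k w <-> exists t, [/\ t < size v,
    w = insert_block inner k t [seq x <- w | x < k] v & argmin_at (size v) t v].

Lemma iota_split3 k m : iota 0 (k + m.+1) = iota 0 k ++ k :: iota k.+1 m.
Proof. by rewrite iotaD. Qed.

Lemma filter_perm_iota_lt k m w : perm_eq w (iota 0 (k + m.+1)) ->
  perm_eq [seq x <- w | x < k] (iota 0 k).
Proof.
move/(perm_filter (ltn^~ k))/perm_trans; apply.
by rewrite (@filter_iota_ltn 0) ?leq_addr.
Qed.

Lemma all_iota_lt k : all (ltn^~ k) (iota 0 k).
Proof. by apply/allP => x; rewrite mem_iota. Qed.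

Lemma all_iota_gt k m : all (ltn k) (iota k.+1 m).
Proof. by apply/allP => x; rewrite mem_iota => /andP[]. Qed.

Lemma filter_perm_iota_gt k m w : perm_eq w (iota 0 (k + m.+1)) ->
  perm_eq [seq x <- w | k < x] (iota k.+1 m).
Proof.
move/(perm_filter (ltn k))/perm_trans; apply.
have /all_filterP E := all_iota_gt k m.
rewrite iota_split3 filter_cat /= ltnn E -[X in perm_eq _ X]cat0s.
rewrite perm_cat2r -(filter_pred0 (iota 0 k)) (@eq_in_filter _ (ltn k) pred0) //.
by move=> x; rewrite mem_iota /=; lia.
Qed.

(** Insertion is a bijection from triples (u, t, v) onto the words counted on the left. The choice
    of the avoiding block u does not constrain t and v, hence the product. *)
Lemma count_min_occ k m :
  count (fun w => occ_at cond k w && ~~ has_occ cond [seq x <- w | x < k])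
      (permutations (iota 0 (k + m.+1))) =
  num_avoiding cond k *
    \sum_(t < m) count (argmin_at m t) (permutations (iota k.+1 m)).
Proof.
pose s1 := [seq u <- permutations (iota 0 k) | ~~ has_occ cond u].
pose s2 := [seq (t, v) | t <- iota 0 m,
                         v <- [seq v <- permutations (iota k.+1 m) | argmin_at m t v]].
have s1P u : u \in s1 -> perm_eq u (iota 0 k) /\ ~~ has_occ cond u.
  by rewrite mem_filter mem_permutations => /andP[].
have s2P tv : tv \in s2 ->
    [/\ tv.1 < m, perm_eq tv.2 (iota k.+1 m) & argmin_at m tv.1 tv.2].
  case/allpairsPdep=> t [v []]; rewrite mem_iota mem_filter mem_permutations.
  by move=> lt_tm /andP[? ?] ->.
have ltP u : perm_eq u (iota 0 k) -> all (ltn^~ k) u.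
  by move/perm_all->; apply: all_iota_lt.
have gtP v : perm_eq v (iota k.+1 m) -> all (ltn k) v.
  by move/perm_all->; apply: all_iota_gt.
have us2 : uniq s2.
  apply: allpairs_uniq_dep => [|t _|]; rewrite ?iota_uniq //.
    by rewrite filter_uniq ?permutations_uniq.
  by move=> [t v] [t' v'] _ _ [-> ->].
pose f u (tv : nat * seq nat) := insert_block inner k tv.1 u tv.2.
rewrite -size_filter.
transitivity (size [seq f u tv | u <- s1, tv <- s2]); last first.
  rewrite size_allpairs size_filter size_allpairs_dep; congr (_ * _).
  rewrite sumnE big_map -(big_mkord xpredT
    (fun t => count (argmin_at m t) (permutations (iota k.+1 m)))).
  rewrite /index_iota subn0.
  by apply: eq_bigr => t _; rewrite size_filter.
(* Two duplicate-free lists with the same members have equal length. Duplicates are excluded by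
   recovering the triple; membership is [occ_atE] read in both directions. *)
apply/perm_size/uniq_perm; first by rewrite filter_uniq ?permutations_uniq.
  apply: allpairs_uniq => //; first by rewrite filter_uniq ?permutations_uniq.
  move=> [u tv] [u' tv'] /allpairsP[[x y] /= [/s1P[pu _] tvP [-> ->]]].
  case/allpairsP=> [[x' y'] /= [/s1P[pu' _] tvP' [-> ->]]] /= eq_f.
  have [lt_t /[dup] pv /gtP gtv _] := s2P _ tvP.
  have [lt_t' /[dup] pv' /gtP gtv' _] := s2P _ tvP'.
  have eq_u : x = x'.
    rewrite -(insert_block_lt inner y.1 (ltP _ pu) gtv) -/(f _ _).
    by rewrite eq_f insert_block_lt ?ltP.
  have eq_v : y.2 = y'.2.
    rewrite -(insert_block_gt inner y.1 (ltP _ pu) gtv) -/(f _ _).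
    by rewrite eq_f insert_block_gt ?ltP.
  have szv : size y.2 = m by rewrite (perm_size pv) size_iota.
  have eq_t : y.1 = y'.1.
    rewrite -(@index_insert_block inner k y.1 x y.2) ?szv //; last exact: ltnW.
    by rewrite -/(f _ _) eq_f index_insert_block // -eq_v szv ltnW.
  by rewrite eq_u [y]surjective_pairing eq_t eq_v -surjective_pairing.
move=> w; rewrite mem_filter mem_permutations; apply/andP/allpairsP.
  move=> [/andP[kw avw] pw].
  have uw : uniq w by rewrite (perm_uniq pw) iota_uniq.
  have pu := filter_perm_iota_lt pw; have pv := filter_perm_iota_gt pw.
  have szv := perm_size pv; rewrite size_iota in szv.
  have [t []] := (occ_atE k uw).1 kw; rewrite szv => lt_tm eq_w vP.
  exists ([seq x <- w | x < k], (t, [seq x <- w | k < x])); split=> //.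
    by rewrite mem_filter avw mem_permutations.
  apply/allpairsPdep; exists t, [seq x <- w | k < x].
  by rewrite mem_iota mem_filter vP mem_permutations.
move=> [[u tv] /= [/s1P[pu avu] /s2P[lt_tm pv vP] ->]].
have [ltu gtv] := (ltP _ pu, gtP _ pv).
have pw : perm_eq (f u tv) (iota 0 (k + m.+1)).
  rewrite (perm_trans (perm_insert_block _ _ _ _ _)) // iota_split3.
  by apply: perm_cat => //; rewrite perm_cons.
split=> //; rewrite insert_block_lt // avu andbT.
have uw : uniq (f u tv) by rewrite (perm_uniq pw) iota_uniq.
apply/(occ_atE k uw); rewrite insert_block_lt // insert_block_gt //.
by exists tv.1; rewrite (perm_size pv) size_iota.
Qed.

End CountInsertions.

(** * Mesh patterns on words *)

Section MeshToWords.
Variable R : {set 'I_3 * 'I_3}.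

Definition mesh_row (a b : nat) (r : 'I_3) (v : nat) : bool :=
  nth false [:: v < a; a < v < b; b < v] r.

Definition mesh_cond U a V b Z : bool :=
  (a < b) &&
  [forall z in R, ~~ has (mesh_row a b z.2) (nth [::] [:: U; V; Z] z.1)].

Variables (n : nat) (s : 'S_n).

Lemma has_slice_word (p : pred nat) l h : h <= n ->
  has p (drop l (take h (word 0 s))) = [exists k : 'I_n, (l <= k < h) && p (s k)].
Proof.
move=> le_hn; apply/hasP/existsP => [[x /(nthP 0)[i]] | [k /andP[/andP[lk kh] pk]]].
  rewrite size_drop size_takel ?size_word // ltn_subRL => lt_ih.
  have lt_in := leq_trans lt_ih le_hn.
  rewrite nth_drop nth_take // (nth_word 0 s (Ordinal lt_in)) => <- px.
  by exists (Ordinal lt_in); rewrite leq_addr lt_ih.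
exists (s k : nat) => //; apply/(nthP 0); exists (k - l).
  by rewrite size_drop size_takel ?size_word // ltn_sub2r // (leq_ltn_trans lk).
by rewrite nth_drop subnKC // nth_take // nth_word.
Qed.

(** The neutral [drop 0] and [take n] give all three columns the slice shape treated by
    [has_slice_word]. *)
Lemma mesh12_occ_word (i j : 'I_n) : i < j ->
  mesh12_occ R s i j =
  mesh_cond (drop 0 (take i (word 0 s))) (s i)
    (drop i.+1 (take j (word 0 s))) (s j) (drop j.+1 (take n (word 0 s))).
Proof.
move=> lt_ij; rewrite /mesh12_occ /mesh_cond lt_ij /=; congr (_ && _).
apply: eq_forallb => -[c r] /=; congr (_ ==> ~~ _).
have row k : (grid_line (s i) (s j) r < (s k).+1 < grid_line (s i) (s j) r.+1) =
             mesh_row (s i) (s j) r (s k).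
  have := ltn_ord (s k).
  by case: r => [[|[|[|//]]] ?] lt_skn;
    rewrite /grid_line /mesh_row /= ?ltnS ?lt_skn ?andbT.
have [lt_in lt_jn] := (ltn_ord i, ltn_ord j).
transitivity [exists k : 'I_n,
  (grid_line i j c < k.+1 < grid_line i j c.+1) && mesh_row (s i) (s j) r (s k)].
  by apply: eq_existsb => k; rewrite /in_box row.
by case: c => [[|[|[|//]]] ?]; rewrite has_slice_word ?(ltnW lt_in) ?(ltnW lt_jn).
Qed.

Lemma mesh12_avoids_word : mesh12_avoids R s = ~~ has_occ mesh_cond (word 0 s).
Proof.
congr (~~ _); apply/existsP/has_occP => [[i /existsP[j ij]] | [a]].
  have lt_ij : i < j by case/andP: ij.
  rewrite mesh12_occ_word // in ij; exists (s i); apply/(occ_atP _ _ (word_uniq 0 s)).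
  exists (drop 0 (take i (word 0 s))), (drop i.+1 (take j (word 0 s))), (s j : nat).
  exists (drop j.+1 (take n (word 0 s))); split=> //.
  have sw := size_word 0 s; have [lt_in lt_jn] := (ltn_ord i, ltn_ord j).
  rewrite drop0 (@take_oversize _ n) ?sw //.
  rewrite -[LHS](cat_take_drop j) (drop_nth 0) ?sw // nth_word.
  rewrite -[X in X ++ _](cat_take_drop i) take_takel ?(ltnW lt_ij) //.
  rewrite [drop i _](drop_nth 0) ?size_takel ?sw ?(ltnW lt_jn) // nth_take // nth_word.
  by rewrite -catA.
move=> /(occ_atP _ _ (word_uniq 0 s))[U [V [b [Z [eq_w cP]]]]].
(* The positions of a and b are read off from the lengths of U and V. *)
have /= := congr1 size eq_w; rewrite size_word size_cat /= size_cat /= => eq_n.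
have lt_in : size U < n by lia.
have lt_jn : size U + (size V).+1 < n by lia.
have ai : s (Ordinal lt_in) = a :> nat.
  by rewrite -[LHS](nth_word 0) eq_w nth_cat ltnn subnn.
have bj : s (Ordinal lt_jn) = b :> nat.
  rewrite -[LHS](nth_word 0) eq_w nth_cat ltnNge leq_addr addKn /=.
  by rewrite nth_cat ltnn subnn.
exists (Ordinal lt_in); apply/existsP; exists (Ordinal lt_jn).
rewrite mesh12_occ_word /=; last by rewrite -addn1 leq_add2l.
rewrite ai bj drop0 (@take_oversize _ n) ?size_word // eq_w.
have -> : take (size U) (U ++ a :: V ++ b :: Z) = U by rewrite take_size_cat.
have eq2 : U ++ a :: V ++ b :: Z = (U ++ a :: V) ++ b :: Z by rewrite -catA.
have sz2 : size (U ++ a :: V) = size U + (size V).+1 by rewrite size_cat.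
have -> : take (size U + (size V).+1) (U ++ a :: V ++ b :: Z) = U ++ a :: V.
  by rewrite eq2 take_size_cat.
have -> : drop (size U).+1 (U ++ a :: V) = V.
  by rewrite -cat_rcons drop_size_cat ?size_rcons.
by rewrite eq2 -cat_rcons drop_size_cat ?size_rcons ?sz2.
Qed.

End MeshToWords.

Lemma num_avoiders_words R n : num_avoiders R n = num_avoiding (mesh_cond R) n.
Proof.
rewrite /num_avoiding count_permutations_iota.
by apply: eq_card => s; rewrite !inE mesh12_avoids_word.
Qed.

(** Agreement is asked on duplicate-free words only, since a mesh does not restrict entries equal to
    a or b. *)
Lemma eq_num_avoiding c1 c2 n :
    (forall U a V b Z, uniq (U ++ a :: V ++ b :: Z) ->
       c1 U a V b Z = c2 U a V b Z) ->
  num_avoiding c1 n = num_avoiding c2 n.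
Proof.
move=> eq_c; apply: eq_in_count => w; rewrite mem_permutations => pw /=.
have uw : uniq w by rewrite (perm_uniq pw) iota_uniq.
congr (~~ _); apply: eq_has => a.
apply/(occ_atP _ _ uw)/(occ_atP _ _ uw) => -[U [V [b [Z [eq_w cP]]]]];
  by exists U, V, b, Z; rewrite ?eq_c -?eq_w // -eq_c -?eq_w.
Qed.

(** * Nesting of occurrences for the three representatives *)

(* In an occurrence (a, b) of U a V b Z the values below a form the block V    *)
(* for [cond_inner], and the block Z for [cond_after] and [cond_before].       *)
Definition cond_inner U a V b Z : bool :=
  [&& a < b, all (ltn b) U, all (ltn^~ a) V & all (ltn a) Z].

Definition cond_after U a V b Z : bool :=
  [&& a < b, all (ltn a) U, all (ltn b) V & all (ltn^~ a) Z].

Definition cond_before U a V b Z : bool :=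
  [&& a < b, all (ltn b) U, all (ltn a) V & all (ltn^~ a) Z].

Lemma all_filterW (T : Type) (p q : pred T) s : all p s -> all p [seq x <- s | q x].
Proof. by rewrite all_filter; apply: sub_all => x /= ->; rewrite implybT. Qed.

Lemma filter_lt_nil a s : all (ltn a) s -> [seq x <- s | x < a] = [::].
Proof. by elim: s => //= x s IHs /andP[/ltnW]; rewrite leqNgt => /negPf->. Qed.

Section FilterOccurrence.
Variable cond : seq nat -> nat -> seq nat -> nat -> seq nat -> bool.
Hypothesis cond_filter : forall (p : pred nat) U a V b Z, cond U a V b Z ->
  cond [seq x <- U | p x] a [seq x <- V | p x] b [seq x <- Z | p x].

(** By [cond_filter], deleting entries other than a and b preserves an occurrence. *)
Lemma occ_at_filter (p : pred nat) U a V b Z : uniq (U ++ a :: V ++ b :: Z) ->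
    cond U a V b Z -> p a -> p b ->
  occ_at cond a [seq x <- U ++ a :: V ++ b :: Z | p x].
Proof.
move=> uw abP pa pb; apply/(occ_atP _ _ (filter_uniq p uw)).
exists [seq x <- U | p x], [seq x <- V | p x], b, [seq x <- Z | p x].
by split; [rewrite filter_cat /= pa filter_cat /= pb | apply: cond_filter].
Qed.

End FilterOccurrence.

(** Used to locate a smaller start a' inside the block: what precedes the block precedes a', and
    what follows a' comes no earlier than the block. *)
Lemma cat_pivot_sub (T : eqType) (A B C D : seq T) x : uniq (A ++ B) ->
    A ++ B = C ++ x :: D -> x \in B -> {subset A <= C} /\ {subset D <= B}.
Proof.
move=> uAB eq_w xB; have := uAB; rewrite cat_uniq => /and3P[_ /hasPn xA _].
have xC : x \notin C.
  by move: uAB; rewrite eq_w cat_uniq => /and3P[_ /hasPn H _]; apply: H; rewrite mem_head.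
have szC : size C = size A + index x B.
  by rewrite -(index_pivot D xC) -eq_w index_cat (negPf (xA x xB)).
split=> y yS.
  have -> : C = take (size C) (A ++ B) by rewrite eq_w take_size_cat.
  by rewrite szC take_cat ltnNge leq_addr /= mem_cat yS.
have eqD : D = drop (size C).+1 (A ++ B).
  by rewrite eq_w -cat_rcons drop_size_cat ?size_rcons.
move: yS; rewrite eqD szC -addnS drop_cat ltnNge leq_addr addKn /=.
exact: mem_drop.
Qed.

(** An occurrence (a', b') in the block V extends to w because U and a exceed b', while b and Z
    exceed a'. Conversely a precedes a', so the condition on U' gives b' < a, and restricting to
    values below a keeps the occurrence. *)
Lemma cond_inner_nested w a a' : uniq w -> a' < a -> occ_at cond_inner a w ->
  occ_at cond_inner a' [seq x <- w | x < a] = occ_at cond_inner a' w.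
Proof.
move=> uw lt_a'a /(occ_atP _ _ uw)[U [V [b [Z [eq_w /and4P[lt_ab Ub Va Za]]]]]].
have Ua : all (ltn a) U by apply: sub_all Ub => x /=; apply: ltn_trans.
have eqV : [seq x <- w | x < a] = V.
  rewrite eq_w filter_cat /= ltnn filter_cat /= ltnNge ltnW //=.
  by rewrite (filter_lt_nil Ua) (filter_lt_nil Za) cats0; apply/all_filterP.
have uV : uniq V by rewrite -eqV filter_uniq.
apply/idP/idP; rewrite eqV.
  move=> /(occ_atP _ _ uV)[U' [V' [b' [Z' [eq_V /and4P[lt_ab' Ub' Va' Za']]]]]].
  have lt_b'a : b' < a.
    by apply: (allP Va); rewrite eq_V mem_cat in_cons mem_cat mem_head !orbT.
  apply/(occ_atP _ _ uw); exists (U ++ a :: U'), V', b', (Z' ++ b :: Z); split.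
    by rewrite eq_w eq_V -!catA /= -!catA.
  rewrite /cond_inner lt_ab' Va' !all_cat /= Ub' Za' lt_b'a (ltn_trans lt_a'a lt_ab) /=.
  rewrite (sub_all _ Ub) => [|x /=]; last by lia.
  by apply: sub_all Za => x /=; lia.
move=> /(occ_atP _ _ uw)[U' [V' [b' [Z' [eq_w' cP]]]]].
have /and4P[lt_ab' Ub' Va' Za'] := cP.
have a'V : a' \in V by rewrite -eqV mem_filter lt_a'a eq_w' mem_cat mem_head orbT.
have [sub _] : {subset rcons U a <= U'} /\ {subset V' ++ b' :: Z' <= V ++ b :: Z}.
  apply: (@cat_pivot_sub _ _ _ _ _ a'); rewrite ?cat_rcons -?eq_w // mem_cat a'V //.
have lt_b'a : b' < a by apply: (allP Ub'); apply: sub; rewrite mem_rcons mem_head.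
rewrite -eqV eq_w'; apply: occ_at_filter => //; rewrite -?eq_w' //.
by move=> p ? ? ? ? ? /and4P[? ? ? ?]; rewrite /cond_inner !all_filterW ?andbT.
Qed.

Lemma filter_lt_after U a V b Z : a < b -> all (ltn a) U -> all (ltn a) V ->
    all (ltn^~ a) Z ->
  [seq x <- U ++ a :: V ++ b :: Z | x < a] = Z.
Proof.
move=> lt_ab Ua Va Za; rewrite filter_cat /= ltnn filter_cat /= ltnNge ltnW //=.
by rewrite (filter_lt_nil Ua) (filter_lt_nil Va); apply/all_filterP.
Qed.

(** The block Z ends the word, so b', coming after a', lies in it. Conversely, the entries before Z
    exceed a', which is all that is required of entries left of a'. *)
Lemma cond_after_nested w a a' : uniq w -> a' < a -> occ_at cond_after a w ->
  occ_at cond_after a' [seq x <- w | x < a] = occ_at cond_after a' w.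
Proof.
move=> uw lt_a'a /(occ_atP _ _ uw)[U [V [b [Z [eq_w /and4P[lt_ab Ua Vb Za]]]]]].
have Va : all (ltn a) V by apply: sub_all Vb => x /=; apply: ltn_trans.
have eqZ : [seq x <- w | x < a] = Z by rewrite eq_w filter_lt_after.
have uZ : uniq Z by rewrite -eqZ filter_uniq.
apply/idP/idP; rewrite eqZ.
  move=> /(occ_atP _ _ uZ)[U' [V' [b' [Z' [eq_Z /and4P[lt_ab' Ua' Vb' Za']]]]]].
  apply/(occ_atP _ _ uw); exists (U ++ a :: V ++ b :: U'), V', b', Z'; split.
    by rewrite eq_w eq_Z -!catA /= -!catA.
  rewrite /cond_after lt_ab' Vb' Za' all_cat /= all_cat /= Ua' lt_a'a.
  rewrite (ltn_trans lt_a'a lt_ab) !andbT /=.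
  by apply/andP; split; [apply: sub_all Ua | apply: sub_all Va] => x /=; lia.
move=> /(occ_atP _ _ uw)[U' [V' [b' [Z' [eq_w' cP]]]]].
have /and4P[lt_ab' Ua' Vb' Za'] := cP.
have a'Z : a' \in Z by rewrite -eqZ mem_filter lt_a'a eq_w' mem_cat mem_head orbT.
have [_ sub] : {subset U ++ a :: rcons V b <= U'} /\ {subset V' ++ b' :: Z' <= Z}.
  apply: (@cat_pivot_sub _ _ _ _ _ a') => //; rewrite -?catA /= cat_rcons -?eq_w //.
have lt_b'a : b' < a by apply: (allP Za); apply: sub; rewrite mem_cat mem_head orbT.
rewrite -eqZ eq_w'; apply: occ_at_filter => //; rewrite -?eq_w' //.
by move=> p ? ? ? ? ? /and4P[? ? ? ?]; rewrite /cond_after !all_filterW ?andbT.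
Qed.

(** As for [cond_after], but the entries before Z must now exceed b'; they do, since b' lies in Z
    and is below a. *)
Lemma cond_before_nested w a a' : uniq w -> a' < a -> occ_at cond_before a w ->
  occ_at cond_before a' [seq x <- w | x < a] = occ_at cond_before a' w.
Proof.
move=> uw lt_a'a /(occ_atP _ _ uw)[U [V [b [Z [eq_w /and4P[lt_ab Ub Va Za]]]]]].
have Ua : all (ltn a) U by apply: sub_all Ub => x /=; apply: ltn_trans.
have eqZ : [seq x <- w | x < a] = Z by rewrite eq_w filter_lt_after.
have uZ : uniq Z by rewrite -eqZ filter_uniq.
apply/idP/idP; rewrite eqZ.
  move=> /(occ_atP _ _ uZ)[U' [V' [b' [Z' [eq_Z /and4P[lt_ab' Ub' Va' Za']]]]]].
  have lt_b'a : b' < a.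
    by apply: (allP Za); rewrite eq_Z mem_cat in_cons mem_cat mem_head !orbT.
  apply/(occ_atP _ _ uw); exists (U ++ a :: V ++ b :: U'), V', b', Z'; split.
    by rewrite eq_w eq_Z -!catA /= -!catA.
  rewrite /cond_before lt_ab' Va' Za' all_cat /= all_cat /= Ub' lt_b'a.
  rewrite (ltn_trans lt_b'a lt_ab) !andbT /=.
  by apply/andP; split; [apply: sub_all Ua | apply: sub_all Va] => x /=; lia.
move=> /(occ_atP _ _ uw)[U' [V' [b' [Z' [eq_w' cP]]]]].
have /and4P[lt_ab' Ub' Va' Za'] := cP.
have a'Z : a' \in Z by rewrite -eqZ mem_filter lt_a'a eq_w' mem_cat mem_head orbT.
have [_ sub] : {subset U ++ a :: rcons V b <= U'} /\ {subset V' ++ b' :: Z' <= Z}.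
  apply: (@cat_pivot_sub _ _ _ _ _ a') => //; rewrite -?catA /= cat_rcons -?eq_w //.
have lt_b'a : b' < a by apply: (allP Za); apply: sub; rewrite mem_cat mem_head orbT.
rewrite -eqZ eq_w'; apply: occ_at_filter => //; rewrite -?eq_w' //.
by move=> p ? ? ? ? ? /and4P[? ? ? ?]; rewrite /cond_before !all_filterW ?andbT.
Qed.

(** * Occurrences as insertions *)

Lemma argmin_atE p T m t v : argmin_at p T m t v =
  all (ltn (nth 0 v (p m t))) [seq nth 0 v q | q <- T m t].
Proof. by rewrite all_map. Qed.

Lemma filter_gt_id k s : all (ltn k) s -> [seq x <- s | k < x] = s.
Proof. by move/all_filterP. Qed.

Lemma filter_gt_nil k s : all (ltn^~ k) s -> [seq x <- s | k < x] = [::].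
Proof. by elim: s => //= x s IHs /andP[/ltnW]; rewrite leqNgt => /negPf->. Qed.

Lemma filter_gt_all k w : all (ltn k) [seq x <- w | k < x].
Proof. exact: filter_all. Qed.

Lemma filter_lt_all k w : all (ltn^~ k) [seq x <- w | x < k].
Proof. exact: (filter_all (ltn^~ k)). Qed.

(** Here v = U b Z and t is the length of U, so b sits at position t and must be least among the
    first t + 1 entries. *)
Lemma cond_inner_occ k w : uniq w ->
  let v := [seq x <- w | k < x] in
  occ_at cond_inner k w <-> exists t, [/\ t < size v,
    w = insert_block true k t [seq x <- w | x < k] v &
    argmin_at (fun _ t => t) (fun _ t => iota 0 t) (size v) t v].
Proof.
move=> uw v; split.
  case/(occ_atP _ _ uw) => U [V [b [Z [eq_w /and4P[lt_kb Ub Vk Zk]]]]].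
  have Uk : all (ltn k) U by apply: sub_all Ub => x /=; apply: ltn_trans.
  have eq_v : v = U ++ b :: Z.
    rewrite /v eq_w filter_cat /= ltnn filter_cat /= lt_kb.
    by rewrite (filter_gt_id Uk) (filter_gt_nil Vk) (filter_gt_id Zk).
  have eq_u : [seq x <- w | x < k] = V.
    rewrite eq_w filter_cat /= ltnn filter_cat /= ltnNge ltnW //=.
    by rewrite (filter_lt_nil Uk) (filter_lt_nil Zk) cats0; apply/all_filterP.
  exists (size U); rewrite eq_v eq_u argmin_atE map_nth_iota0 ?size_cat ?leq_addr //.
  rewrite /insert_block take_size_cat // drop_size_cat // nth_cat ltnn subnn.
  by split=> //=; rewrite addnS ltnS leq_addr.
case=> t [lt_tv eq_w]; rewrite argmin_atE map_nth_iota0 ?(ltnW lt_tv) // => Ub.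
apply/(occ_atP _ _ uw); exists (take t v), [seq x <- w | x < k], (nth 0 v t).
exists (drop t.+1 v); rewrite -drop_nth //; split=> //.
have vk := filter_gt_all k w; rewrite -/v in vk.
have kb : k < nth 0 v t by apply: (allP vk); rewrite mem_nth.
rewrite /cond_inner kb Ub filter_lt_all /=.
by apply/allP => x /mem_drop/(allP vk).
Qed.

(** When the block ends the word, the last entry of v stands just before it and plays the part of
    b. *)
Lemma insert_block_last k w t : let v := [seq x <- w | k < x] in
    t < size v -> w = insert_block false k t [seq x <- w | x < k] v ->
  w = take t v ++ k :: take ((size v).-1 - t) (drop t v)
        ++ nth 0 v (size v).-1 :: [seq x <- w | x < k].
Proof.
move=> v lt_tv {1}->; rewrite /insert_block; congr (_ ++ _ :: _).
rewrite -cat_rcons; congr (_ ++ _).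
have v_gt0 : 0 < size v by apply: leq_ltn_trans lt_tv.
have sz : size (drop t v) = ((size v).-1 - t).+1.
  by rewrite size_drop -subSn ?prednK // -ltnS prednK.
rewrite -[LHS](take_size) sz (take_nth 0) ?sz // nth_drop subnKC //.
by rewrite -ltnS prednK.
Qed.

Lemma filters_after w k U V b Z : w = U ++ k :: V ++ b :: Z -> k < b ->
    all (ltn k) U -> all (ltn k) V -> all (ltn^~ k) Z ->
  [seq x <- w | k < x] = U ++ rcons V b /\ [seq x <- w | x < k] = Z.
Proof.
move=> -> lt_kb Uk Vk Zk; split; last exact: filter_lt_after.
rewrite filter_cat /= ltnn filter_cat /= lt_kb.
by rewrite (filter_gt_id Uk) (filter_gt_id Vk) (filter_gt_nil Zk) cats1.
Qed.

Lemma nth_cat_rcons_last (U V : seq nat) b :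
  nth 0 (U ++ rcons V b) (size U + size V) = b.
Proof.
by rewrite nth_cat ltnNge leq_addr addKn nth_rcons ltnn eqxx.
Qed.

(** Here v = U V b: the entry b is last, and V occupies the positions from t to m - 2, so b is least
    among m - t entries. *)
Lemma cond_after_occ k w : uniq w ->
  let v := [seq x <- w | k < x] in
  occ_at cond_after k w <-> exists t, [/\ t < size v,
    w = insert_block false k t [seq x <- w | x < k] v &
    argmin_at (fun m _ => m.-1) (fun m t => iota t (m.-1 - t)) (size v) t v].
Proof.
move=> uw v; split.
  case/(occ_atP _ _ uw) => U [V [b [Z [eq_w /and4P[lt_kb Uk Vb Zk]]]]].
  have Vk : all (ltn k) V by apply: sub_all Vb => x /=; apply: ltn_trans.
  have [eq_v eq_u] := filters_after eq_w lt_kb Uk Vk Zk.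
  have sz_v : size v = (size U + size V).+1.
    by rewrite /v eq_v size_cat size_rcons addnS.
  exists (size U); rewrite argmin_atE map_nth_iota; last by rewrite leq_sub2r ?leq_pred.
  rewrite sz_v /= /v eq_v eq_u /insert_block take_size_cat // drop_size_cat // addKn.
  rewrite cat_rcons (nth_cat_rcons_last U V b).
  by rewrite -cats1 take_size_cat // ltnS leq_addr.
case=> t [lt_tv /(insert_block_last lt_tv) eq_w].
rewrite argmin_atE map_nth_iota; last by rewrite leq_sub2r ?leq_pred.
move=> Vb; apply/(occ_atP _ _ uw); do 4!eexists; split; first exact: eq_w.
have vk := filter_gt_all k w; rewrite -/v in vk.
have kb : k < nth 0 v (size v).-1.
  by apply: (allP vk); rewrite mem_nth ?ltn_predL ?(leq_ltn_trans _ lt_tv).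
rewrite /cond_after kb Vb filter_lt_all /=.
by rewrite andbT; apply/allP => x /mem_take/(allP vk).
Qed.

(** Again v = U V b with b last, but its competitors are now the t entries of U. *)
Lemma cond_before_occ k w : uniq w ->
  let v := [seq x <- w | k < x] in
  occ_at cond_before k w <-> exists t, [/\ t < size v,
    w = insert_block false k t [seq x <- w | x < k] v &
    argmin_at (fun m _ => m.-1) (fun _ t => iota 0 t) (size v) t v].
Proof.
move=> uw v; split.
  case/(occ_atP _ _ uw) => U [V [b [Z [eq_w /and4P[lt_kb Ub Vk Zk]]]]].
  have Uk : all (ltn k) U by apply: sub_all Ub => x /=; apply: ltn_trans.
  have [eq_v eq_u] := filters_after eq_w lt_kb Uk Vk Zk.
  have sz_v : size v = (size U + size V).+1.
    by rewrite /v eq_v size_cat size_rcons addnS.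
  exists (size U); rewrite argmin_atE map_nth_iota0; last first.
    by rewrite sz_v ltnW // ltnS leq_addr.
  rewrite sz_v /= /v eq_v eq_u /insert_block take_size_cat // drop_size_cat //.
  rewrite cat_rcons (nth_cat_rcons_last U V b).
  by rewrite ltnS leq_addr.
case=> t [lt_tv /(insert_block_last lt_tv) eq_w].
rewrite argmin_atE map_nth_iota0 ?(ltnW lt_tv) // => Ub.
apply/(occ_atP _ _ uw); do 4!eexists; split; first exact: eq_w.
have vk := filter_gt_all k w; rewrite -/v in vk.
have kb : k < nth 0 v (size v).-1.
  by apply: (allP vk); rewrite mem_nth ?ltn_predL ?(leq_ltn_trans _ lt_tv).
rewrite /cond_before kb Ub filter_lt_all /=.
by rewrite andbT; apply/allP => x /mem_take/mem_drop/(allP vk).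
Qed.

(** * The recurrence and the generating function *)

Section Recurrence.
Local Open Scope ring_scope.
Variable cond : seq nat -> nat -> seq nat -> nat -> seq nat -> bool.
Variables (inner : bool) (p : nat -> nat -> nat) (T : nat -> nat -> seq nat).

Hypothesis nested : forall w a a', uniq w -> (a' < a)%N -> occ_at cond a w ->
  occ_at cond a' [seq x <- w | (x < a)%N] = occ_at cond a' w.
Hypothesis occ_atE : forall k w, uniq w ->
  let v := [seq x <- w | (k < x)%N] in
  occ_at cond k w <-> exists t, [/\ (t < size v)%N,
    w = insert_block inner k t [seq x <- w | (x < k)%N] v &
    argmin_at p T (size v) t v].
Hypothesis pT : forall m t, (t < m)%N ->
  uniq (p m t :: T m t) && all (ltn^~ m) (p m t :: T m t).
Hypothesis sumT : forall m, \sum_(t < m) ((size (T m t)).+1%:R : rat)^-1 = harmonic m.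

Lemma num_avoiding_rec n :
  (num_avoiding cond n)%:R +
    \sum_(k < n) (num_avoiding cond k)%:R * fact_harmonic_gf (n - k.+1)%N = (n`!)%:R.
Proof.
rewrite -(sum_min_occ nested n) natrD natr_sum; congr (_ + _).
apply: eq_bigr => -[k /= lt_kn] _; have [m ->] : exists m, n = (k + m.+1)%N.
  by exists (n - k.+1)%N; rewrite addnS -addSn subnKC.
have -> : (k + m.+1 - k.+1 = m)%N by rewrite addnS -addSn addKn.
rewrite (count_min_occ occ_atE) natrM natr_sum; congr (_ * _).
(* The zero constant term agrees with the empty harmonic sum at m = 0. *)
have -> : fact_harmonic_gf m = (m`!)%:R * harmonic m.
  by rewrite /fact_harmonic_gf; case: eqP => // ->; rewrite /harmonic big_geq ?mulr0.
rewrite -sumT mulr_sumr; apply: eq_bigr => t _.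
have /andP[uT ltT] := pT (ltn_ord t).
rewrite -(count_argmin k.+1 uT ltT) natrM mulrC mulrA mulVf ?mul1r //.
by rewrite pnatr_eq0.
Qed.

Lemma num_avoiding_gf :
  (fun n => (num_avoiding cond n)%:R : rat) =1
  (factorial_gf / (1 + 'X * fact_harmonic_gf))%fps.
Proof.
have X_mul n : ('X * fact_harmonic_gf)%fps n.+1 = fact_harmonic_gf n.
  rewrite /fps_mul (bigD1 (inord 1)) //= inordK // big1 => [|i ne_i1].
    by rewrite /fps_X eqxx mul1r addr0 subSS subn0.
  have : (i != 1 :> nat)%N.
    by apply: contra ne_i1 => /eqP i1; apply/eqP/val_inj; rewrite /= inordK.
  by rewrite /fps_X => /negPf->; rewrite mul0r.
apply: fps_div_unique => [|n].
  by rewrite /fps_add /fps_mul big_ord1 /fps_X /fps_one mul0r addr0 oner_eq0.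
(* The top term of the convolution meets the constant term 1 of the denominator; the others meet the
   shifted harmonic coefficients. *)
rewrite /factorial_gf -num_avoiding_rec {1}/fps_mul big_ord_recr /= subnn addrC.
congr (_ + _).
  by rewrite /fps_add /fps_mul big_ord1 /fps_X /fps_one mul0r addr0 mulr1.
apply: eq_bigr => k _; congr (_ * _).
have -> : (n - k = (n - k.+1).+1)%N by rewrite subnSK.
by rewrite /fps_add X_mul /fps_one add0r.
Qed.

End Recurrence.

Lemma sum_inv_harmonic m : (\sum_(t < m) (t.+1%:R : rat)^-1 = harmonic m)%R.
Proof. by rewrite /harmonic big_add1 big_mkord. Qed.

Lemma sum_inv_harmonic_rev m :
  (\sum_(t < m) ((m.-1 - t).+1%:R : rat)^-1 = harmonic m)%R.
Proof.
rewrite -sum_inv_harmonic (reindex_inj rev_ord_inj) /=.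
apply: eq_bigr => t _; congr (_%:R^-1)%R; have := ltn_ord t; lia.
Qed.

(** * The three representative patterns *)

Definition mesh_inner : {set 'I_3 * 'I_3} :=
  [set box 1 2; box 0 1; box 1 1; box 0 0; box 2 0].
Definition mesh_after : {set 'I_3 * 'I_3} :=
  [set box 2 2; box 1 1; box 2 1; box 0 0; box 1 0].
Definition mesh_before : {set 'I_3 * 'I_3} :=
  [set box 2 2; box 0 1; box 2 1; box 0 0; box 1 0].

Lemma forall_set5 (T : finType) (P : pred T) x1 x2 x3 x4 x5 :
  [forall x in [set x1; x2; x3; x4; x5], P x] = [&& P x1, P x2, P x3, P x4 & P x5].
Proof.
apply/forall_inP/and5P => [H | [H1 H2 H3 H4 H5] x].
  by split; apply: H; rewrite !inE eqxx ?orbT.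
by rewrite !inE -!orbA => /or4P[|||/orP[]] /eqP->.
Qed.

(** Entries other than a and b lie strictly inside a row, so excluding rows confines them to the
    remaining ones. *)
Lemma uniq_pivots U (a : nat) V b Z : uniq (U ++ a :: V ++ b :: Z) ->
  let neq x := x != a /\ x != b in
  [/\ {in U, forall x, neq x}, {in V, forall x, neq x} & {in Z, forall x, neq x}].
Proof.
move=> uw neq; have : uniq (a :: b :: U ++ V ++ Z).
  rewrite -(@perm_uniq _ (U ++ a :: V ++ b :: Z)) //.
  by apply/seq.permP => P; rewrite /= !count_cat /= !count_cat /=; lia.
rewrite /= inE !mem_cat !negb_or => /and3P[/and4P[_ aU aV aZ] /and3P[bU bV bZ] _].
by split=> x xS; split; apply: contraTneq xS => ->.
Qed.

Ltac lia_at x :=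
  repeat match goal with
  | H : _, xS : is_true (x \in _) |- _ => move: (H x xS); clear H
  end; rewrite /=; lia.

(** Column by column: U avoids the two lower rows, V the two upper ones, and Z the lowest. *)
Lemma mesh_innerE U a V b Z : uniq (U ++ a :: V ++ b :: Z) ->
  mesh_cond mesh_inner U a V b Z = cond_inner U a V b Z.
Proof.
move=> /uniq_pivots[HU HV HZ].
rewrite /mesh_cond forall_set5 /cond_inner /mesh_row /= -!all_predC.
case: (ltnP a b) => //= lt_ab; apply/and5P/and3P.
  move=> [/allP h1 /allP h2 /allP h3 /allP h4 /allP h5].
  by split; apply/allP => x xS; lia_at x.
move=> [/allP h1 /allP h2 /allP h3].
by split; apply/allP => x xS; lia_at x.
Qed.

Lemma mesh_afterE U a V b Z : uniq (U ++ a :: V ++ b :: Z) ->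
  mesh_cond mesh_after U a V b Z = cond_after U a V b Z.
Proof.
move=> /uniq_pivots[HU HV HZ].
rewrite /mesh_cond forall_set5 /cond_after /mesh_row /= -!all_predC.
case: (ltnP a b) => //= lt_ab; apply/and5P/and3P.
  move=> [/allP h1 /allP h2 /allP h3 /allP h4 /allP h5].
  by split; apply/allP => x xS; lia_at x.
move=> [/allP h1 /allP h2 /allP h3].
by split; apply/allP => x xS; lia_at x.
Qed.

Lemma mesh_beforeE U a V b Z : uniq (U ++ a :: V ++ b :: Z) ->
  mesh_cond mesh_before U a V b Z = cond_before U a V b Z.
Proof.
move=> /uniq_pivots[HU HV HZ].
rewrite /mesh_cond forall_set5 /cond_before /mesh_row /= -!all_predC.
case: (ltnP a b) => //= lt_ab; apply/and5P/and3P.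
  move=> [/allP h1 /allP h2 /allP h3 /allP h4 /allP h5].
  by split; apply/allP => x xS; lia_at x.
move=> [/allP h1 /allP h2 /allP h3].
by split; apply/allP => x xS; lia_at x.
Qed.

Notation target_gf := (factorial_gf / (1 + 'X * fact_harmonic_gf))%fps
  (only parsing).

Lemma mesh_inner_gf : avoiders_gf mesh_inner =1 target_gf.
Proof.
move=> n; rewrite /avoiders_gf num_avoiders_words (eq_num_avoiding _ mesh_innerE).
apply: (num_avoiding_gf cond_inner_nested cond_inner_occ).
  move=> m t lt_tm /=; rewrite mem_iota ltnn andbF iota_uniq lt_tm /=.
  by apply/allP => q; rewrite mem_iota => /ltn_trans; apply.
by move=> m; under eq_bigr => t _ do rewrite size_iota; apply: sum_inv_harmonic.
Qed.

Lemma mesh_after_gf : avoiders_gf mesh_after =1 target_gf.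
Proof.
move=> n; rewrite /avoiders_gf num_avoiders_words (eq_num_avoiding _ mesh_afterE).
apply: (num_avoiding_gf cond_after_nested cond_after_occ).
  move=> m t lt_tm /=; rewrite mem_iota iota_uniq.
  apply/and3P; split; [lia | lia |].
  by apply/allP => q; rewrite mem_iota; lia.
by move=> m; under eq_bigr => t _ do rewrite size_iota; apply: sum_inv_harmonic_rev.
Qed.

Lemma mesh_before_gf : avoiders_gf mesh_before =1 target_gf.
Proof.
move=> n; rewrite /avoiders_gf num_avoiders_words (eq_num_avoiding _ mesh_beforeE).
apply: (num_avoiding_gf cond_before_nested cond_before_occ).
  move=> m t lt_tm /=; rewrite mem_iota iota_uniq.
  apply/and3P; split; [lia | lia |].
  by apply/allP => q; rewrite mem_iota; lia.
by move=> m; under eq_bigr => t _ do rewrite size_iota; apply: sum_inv_harmonic.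
Qed.

(** * Transport to the ten patterns *)

Lemma avoiders_gf_inv R : avoiders_gf R =1 target_gf ->
  avoiders_gf [set z | (z.2, z.1) \in R] =1 target_gf.
Proof. by move=> RE n; rewrite -RE /avoiders_gf num_avoiders_inv. Qed.

Lemma avoiders_gf_revcomp R : avoiders_gf R =1 target_gf ->
  avoiders_gf [set z | (rev_ord z.1, rev_ord z.2) \in R] =1 target_gf.
Proof. by move=> RE n; rewrite -RE /avoiders_gf num_avoiders_revcomp. Qed.

Ltac eq_boxes :=
  apply/setP => -[[[|[|[|//]]] ?] [[|[|[|//]]] ?]]; rewrite !inE.

Theorem theorem7p1 (R : {set 'I_3 * 'I_3})
  (hR : R \in
    [:: [set box 1 2; box 2 2; box 0 1; box 1 1; box 0 0];
        [set box 2 2; box 1 1; box 2 1; box 0 0; box 1 0];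
        [set box 1 2; box 2 2; box 0 1; box 2 1; box 0 0];
        [set box 1 2; box 2 2; box 0 1; box 0 0; box 1 0];
        [set box 1 2; box 2 2; box 2 1; box 0 0; box 1 0];
        [set box 2 2; box 0 1; box 2 1; box 0 0; box 1 0];
        [set box 0 2; box 2 2; box 1 1; box 2 1; box 1 0];
        [set box 0 2; box 1 1; box 2 1; box 0 0; box 1 0];
        [set box 1 2; box 2 2; box 0 1; box 1 1; box 2 0];
        [set box 1 2; box 0 1; box 1 1; box 0 0; box 2 0]]) :
  avoiders_gf R =1 (factorial_gf / (1 + 'X * fact_harmonic_gf))%fps.
Proof.
have eq_gf S : avoiders_gf S =1 target_gf -> R = S -> avoiders_gf R =1 target_gf.
  by move=> SE ->.
(* The orbits of [mesh_before] and [mesh_inner] under the two symmetries have four members each.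
   That of [mesh_after] has two, as its reverse complement is its transpose. *)
move: hR; rewrite !inE => /orP[|/orP[|/orP[|/orP[|/orP[|/orP[|/orP[|/orP[|/orP[]]]]]]]]];
  move/eqP => eqR.
- by refine (eq_gf _ (avoiders_gf_inv mesh_after_gf) _); rewrite eqR; eq_boxes.
- exact: (eq_gf _ mesh_after_gf eqR).
- by refine (eq_gf _ (avoiders_gf_revcomp mesh_before_gf) _); rewrite eqR; eq_boxes.
- by refine (eq_gf _ (avoiders_gf_inv mesh_before_gf) _); rewrite eqR; eq_boxes.
- by refine (eq_gf _ (avoiders_gf_inv (avoiders_gf_revcomp mesh_before_gf)) _);
    rewrite eqR; eq_boxes.
- exact: (eq_gf _ mesh_before_gf eqR).
- by refine (eq_gf _ (avoiders_gf_revcomp mesh_inner_gf) _); rewrite eqR; eq_boxes.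
- by refine (eq_gf _ (avoiders_gf_inv mesh_inner_gf) _); rewrite eqR; eq_boxes.
- by refine (eq_gf _ (avoiders_gf_inv (avoiders_gf_revcomp mesh_inner_gf)) _);
    rewrite eqR; eq_boxes.
- exact: (eq_gf _ mesh_inner_gf eqR).
Qed.
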